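(* Let $T>0$, let $\varphi\in\mathcal{L}$, and let $L$ be the Lagrangian associated with $\varphi$ as in the context (extended to all $t\in\mathbb{R}$ as described there). Then $L$ satisfies the Loewen-Rockafellar condition: for every $r>0$ there exists $k>0$ such that for every $(t,x,v)\in\mathbb{R}\times[-r,r]\times\mathbb{R}$ and every $(w_1,w_2,p)\in\partial L(t,x,v)$ one has $$|(w_1,w_2)|\le k\,(1+|v|+|L(t,x,v)|)(1+|p|).$$
   Context: $\mathcal{L}$ is the family of locally Lipschitz functions $\varphi:[0,T]\times\mathbb{R}\to[0,+\infty)$ such that $\varphi(t,x)=0$ if and only if $t=x$. For $\varphi\in\mathcal{L}$ the associated Lagrangian $L:[0,T]\times\mathbb{R}\times\mathbb{R}\to\mathbb{R}\cup\{+\infty\}$ is $$L(t,x,v)=\begin{cases}+\infty & \text{if } |v|>2,\ t\neq x,\\ \frac{|v|}{2\varphi(t,x)} & \text{if } |v|\le 2,\ t\ne x,\\ 0 & \text{if } v=0,\ t=x,\\ +\infty & \text{if } v\neq 0,\ t=x.\end{cases}$$ It is extended to $t\in\mathbb{R}$ by $L(t,x,v):=L(0,x,v)$ for $t<0$ and $L(t,x,v):=L(T,x,v)$ for $t>T$. For $f:\mathbb{R}^m\to\mathbb{R}\cup\{+\infty\}$ and $z$ with $f(z)<+\infty$, the (regular) subdifferential $\partial f(z)$ is the set of $v\in\mathbb{R}^m$ such that $\liminf_{y\to z}\frac{f(y)-f(z)-\langle v,y-z\rangle}{|y-z|}\ge 0$; at points where $f=+\infty$ there are no subgradients. $|\cdot|$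 is the Euclidean norm. *)

(* Defs.v *)
From HB Require Import structures.
From mathcomp Require Import all_boot all_order all_algebra.
From mathcomp Require Import all_classical all_reals all_analysis.

Set Implicit Arguments.
Unset Strict Implicit.
Unset Printing Implicit Defensive.

Import Order.TTheory GRing.Theory Num.Theory.
Import numFieldNormedType.Exports.

Local Open Scope classical_set_scope.
Local Open Scope ring_scope.

Definition dot (R : realType) (m : nat) (u v : 'rV[R]_m) : R :=
  \sum_(i < m) u 0 i * v 0 i.

(* The library's norm `|u| on row vectors is the sup norm, hence this one. *)
Definition enorm (R : realType) (m : nat) (u : 'rV[R]_m) : R :=
  Num.sqrt (dot u u).

Definition vec2 (R : realType) (a b : R) : 'rV[R]_2 :=
  \row_(i < 2) [:: a; b]`_i.

Definition vec3 (R : realType) (a b c : R) : 'rV[R]_3 :=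
  \row_(i < 3) [:: a; b; c]`_i.

(* The liminf is over the punctured neighbourhoods z^' of z.  The functions of
   interest never take the value -oo, so f z < +oo means that f z is finite. *)
Definition subdifferential (R : realType) (m : nat) (f : 'rV[R]_m -> \bar R)
    (z : 'rV[R]_m) : set 'rV[R]_m :=
  [set v | (f z < +oo)%E /\
    (0 <= limf_einf (fun y : 'rV[R]_m =>
            (f y - f z - (dot v (y - z))%:E) * ((enorm (y - z))^-1)%:E)
          z^')%E].

(* Functions on [0, T] x R are total functions whose values outside this strip
   are irrelevant. The library's [locally [lipschitz _ | _ in A]] asks for a
   Lipschitz bound on A * A near every pair (y, z) of points of A: pairs (z, z)
   give the usual local Lipschitz condition at z relative to A, and it implies
   the condition at pairs of distinct points. *)
Definition classL (R : realType) (T : R) (phi : R * R -> R) : Prop :=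
  let A := [set z : R * R | z.1 \in `[0, T]] in
  [/\ [locally [lipschitz phi z | z in A]],
      forall z, A z -> 0 <= phi z
    & forall t x, A (t, x) -> phi (t, x) = 0 <-> t = x].

(* The Lagrangian for t in [0, T]. *)
Definition lagrangian0 (R : realType) (phi : R * R -> R) (t x v : R) : \bar R :=
  if t == x then (if v == 0 then 0%E else +oo%E)
  else if `|v| <= 2 then (`|v| / (2 * phi (t, x)))%:E else +oo%E.

(* Its extension to all t. *)
Definition lagrangian (R : realType) (T : R) (phi : R * R -> R) (t x v : R) :
    \bar R :=
  if t < 0 then lagrangian0 phi 0 x v
  else if T < t then lagrangian0 phi T x v
  else lagrangian0 phi t x v.

Definition on_rV3 (R : realType) (L : R -> R -> R -> \bar R) (z : 'rV[R]_3) :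
    \bar R :=
  L (z 0 0) (z 0 1) (z 0 2%:R).

(* Main.v *)
Require Import Defs.
From HB Require Import structures.
From mathcomp Require Import all_boot all_order all_algebra.
From mathcomp Require Import all_classical all_reals all_analysis.
From mathcomp Require Import ring lra.

Set Implicit Arguments.
Unset Strict Implicit.
Unset Printing Implicit Defensive.

Import Order.TTheory GRing.Theory Num.Theory.
Import numFieldNormedType.Exports.

Local Open Scope classical_set_scope.
Local Open Scope ring_scope.

(** A subgradient is bounded along each ray by the growth of the function along
that ray ([subdifferential_dir]); the directions (w1, w2, 0) and (0, 0, - v)
suffice. Write
q(t, x) for phi at (t clamped to [0, T], x), so that by [lagrangianE] the
extended Lagrangian is the one on the strip composed with the clamping of t.

If v = 0, the Lagrangian vanishes at all points (t', x', 0), and the ray in the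
direction (w1, w2, 0) gives |(w1, w2)|^2 <= 0.

If v is nonzero and L is finite at (t, x, v), then q > 0 and L = |v| / (2 q)
near (t, x) for this v. Replacing v by (1 - h) v keeps |v| <= 2 and decreases L by
h |v| / (2 q), hence 1 / q <= 2 |p|, also on the boundary |v| = 2. Along
(w1, w2, 0), the function L grows at most like |v| k / q^2 times the length of
that direction, where k is a local Lipschitz constant of phi, hence
|(w1, w2)| <= k |v| / q^2 = 2 k L / q <= 4 k L |p|.

The clamped time and x range over the compact set [0, T] x [-r, r], on which k
can be chosen uniformly ([locally_lipschitz_compact]); the constant 4 k then
works. *)

(** * Subgradients along rays *)

Lemma dotZr (R : realType) (m : nat) (c : R) (u v : 'rV[R]_m) :
  dot u (c *: v) = c * dot u v.
Proof. by rewrite mulr_sumr; apply: eq_bigr => i _; rewrite mxE; ring. Qed.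

Lemma dot_ge0 (R : realType) (m : nat) (u : 'rV[R]_m) : 0 <= dot u u.
Proof. by apply: sumr_ge0 => i _; rewrite -expr2 sqr_ge0. Qed.

Lemma enormZ (R : realType) (m : nat) (c : R) (u : 'rV[R]_m) :
  0 <= c -> enorm (c *: u) = c * enorm u.
Proof.
move=> c0; rewrite /enorm dotZr.
have -> : dot (c *: u) u = c * dot u u.
  by rewrite mulr_sumr; apply: eq_bigr => i _; rewrite mxE; ring.
by rewrite mulrA -expr2 sqrtrM ?sqr_ge0 // sqrtr_sqr ger0_norm.
Qed.

Lemma enorm_gt0 (R : realType) (m : nat) (u : 'rV[R]_m) :
  u != 0 -> 0 < enorm u.
Proof.
move=> u0; rewrite sqrtr_gt0 lt_neqAle dot_ge0 andbT eq_sym.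
apply: contra u0 => /eqP du; apply/eqP/rowP => i; rewrite mxE.
move: du => /psumr_eq0P du; apply/eqP.
by rewrite -sqrf_eq0 expr2 du // => j _; rewrite -expr2 sqr_ge0.
Qed.

(** Along the ray z + h d the difference quotient of the subdifferential is at
most (c - <v, d>) / |d|, and every punctured neighbourhood of z meets the ray;
so this number bounds the lower limit, which is nonnegative. *)
Lemma subdifferential_dir (R : realType) (m : nat) (f : 'rV[R]_m -> \bar R)
    (z v d : 'rV[R]_m) (a c : R) :
  f z = a%:E -> subdifferential f z v ->
  (\forall h \near 0^'+, (f (z + h *: d)%R <= (a + c * h)%:E)%E) ->
  dot v d <= c.
Proof.
move=> fz [_ +] fd; have [dE|d0] := eqVneq d 0.
  move=> _; have -> : dot v d = 0 by
    rewrite dE; apply: big1 => i _; rewrite mxE mulr0.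
  near (0 : R)^'+ => h.
  have h0 : 0 < h by near: h; exact: nbhs_right_gt.
  have : (f (z + h *: d)%R <= (a + c * h)%:E)%E by near: h.
  by rewrite dE scaler0 addr0 fz lee_fin lerDl pmulr_lge0.
rewrite limf_einfE => /le_trans-/(_ ((c - dot v d) / enorm d)%:E) H.
suff : 0 <= (c - dot v d) / enorm d.
  by rewrite pmulr_lge0 ?invr_gt0 ?enorm_gt0 // subr_ge0.
rewrite -lee_fin; apply: H; apply: ge_ereal_sup => _ [V zV <-].
have cvg_ray : z + h *: d @[h --> 0^'+] --> z^'.
  move=> U zU.
  have cz : z + h *: d @[h --> (0 : R)^'+] --> z.
    apply: cvg_at_right_filter.
    rewrite -[X in _ --> X]addr0 -(scale0r d).
    by apply: cvgD; [exact: cvg_cst|apply: cvgZr_tmp; exact: cvg_id].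
  suff : \forall h \near (0 : R)^'+, U (z + h *: d) by [].
  near=> h; have h0 : 0 < h by near: h; exact: nbhs_right_gt.
  have : z + h *: d != z.
    by rewrite -subr_eq0 addrAC subrr add0r scaler_eq0 negb_or gt_eqF.
  by near: h; exact: cz zU.
have : \forall h \near 0^'+, V (z + h *: d) by apply: cvg_ray.
move=> Vd; near (0 : R)^'+ => h.
have h0 : 0 < h by near: h; exact: nbhs_right_gt.
apply: (@le_trans _ _ ((f (z + h *: d)%R - f z - (dot v (z + h *: d - z)%R)%:E)
   * ((enorm (z + h *: d - z)%R)^-1)%:E)%E).
  by apply: ereal_inf_lbound; exists (z + h *: d) => //; near: h.
have -> : z + h *: d - z = h *: d by rewrite addrAC subrr add0r.
rewrite dotZr (enormZ d (ltW h0)) fz.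
have -> : (c - dot v d) / enorm d = (c * h - h * dot v d) * (h * enorm d)^-1.
  by field; rewrite !gt_eqF ?enorm_gt0.
rewrite [leRHS]EFinM; apply: lee_wpmul2r.
  by rewrite lee_fin invr_ge0 mulr_ge0 ?ltW // enorm_gt0.
rewrite [leRHS]EFinB leeD2r // leeBlDr // -EFinD [in leRHS]addrC.
near: h; exact: fd.
Unshelve. all: by end_near. Qed.

(** * Uniform local Lipschitz constants *)

(** A constant valid near z is also valid near each point close to z, and so is
any larger one; compactness then yields a constant common to all of K. The
bound compares a point of K with all nearby points of A, also outside K. *)
Lemma locally_lipschitz_compact (R : realType) (V W : normedModType R)
    (f : V -> W) (A K : set V) :
  [locally [lipschitz f x | x in A]] -> compact K -> K `<=` A ->
  exists2 k : R, 0 < k & forall z, K z ->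
    \forall y \near z, A y -> `|f y - f z| <= k * `|y - z|.
Proof.
move=> lipf /compact_near_coveringP cK KA.
pose P k (z : V) := \forall y \near (z, z),
  (A `*` A) y -> `|f y.1 - f y.2| <= k * `|y.1 - y.2|.
have : \forall k \near +oo, K `<=` P k.
  apply: cK => z /KA Az.
  have [k [_ kP]] := lipf (z, z) (conj Az Az).
  have kz : P (k + 1) z by apply: kP; rewrite ltrDl.
  near=> y l => /=.
  have kl : k + 1 <= l by near: l; by apply: nbhs_pinfty_ge; rewrite num_real.
  have : P (k + 1) y.
    near: y.
    (* A neighbourhood of (z, z) is one of (y, y) for all y near z. *)
    have /near_join nz : \forall y \near (z, z), (A `*` A) y ->
      `|f y.1 - f y.2| <= (k + 1) * `|y.1 - y.2| by [].
    have cyy : (y, y) @[y --> z] --> (z, z) by apply: cvg_pair; exact: cvg_id.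
    exact: cyy nz.
  by apply: filterS => x /[apply] /le_trans; apply; exact: ler_wpM2r.
move=> /(filterI (nbhs_pinfty_gt (num_real 0))) kP.
have [k [k0 kK]] := filter_ex kP.
exists k => // z Kz.
have cyz : (y, z) @[y --> z] --> (z, z).
  by apply: cvg_pair; [exact: cvg_id|exact: cvg_cst].
have : \forall y \near z, (A `*` A) (y, z) -> `|f y - f z| <= k * `|y - z|.
  exact: cyz (kK z Kz).
by apply: filterS => y + Ay; apply; split=> //; exact: KA.
Unshelve. all: by end_near. Qed.

(** * Coordinates in the plane and in space *)

Lemma vec3_ray (R : realType) (a b c a' b' c' h : R) :
  vec3 a b c + h *: vec3 a' b' c' = vec3 (a + h * a') (b + h * b') (c + h * c').
Proof. by apply/rowP => -[[|[|[|//]]] ?]; rewrite !mxE. Qed.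

Lemma dot_vec3 (R : realType) (a b c a' b' c' : R) :
  dot (vec3 a b c) (vec3 a' b' c') = a * a' + b * b' + c * c'.
Proof. by rewrite /dot !big_ord_recr big_ord0 /= !mxE add0r. Qed.

Lemma enorm_vec2_sqr (R : realType) (a b : R) :
  enorm (vec2 a b) ^+ 2 = a * a + b * b.
Proof.
rewrite sqr_sqrtr ?dot_ge0 //.
by rewrite /dot !big_ord_recr big_ord0 /= !mxE add0r.
Qed.

Lemma normr_le_enorm (R : realType) (m : nat) (u : 'rV[R]_m) (i : 'I_m) :
  `|u 0 i| <= enorm u.
Proof.
rewrite -sqrtr_sqr; apply: ler_wsqrtr.
rewrite /dot (bigD1 i) //= -expr2 lerDl.
by apply: sumr_ge0 => j _; rewrite -expr2 sqr_ge0.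
Qed.

Lemma on_rV3_vec3 (R : realType) (L : R -> R -> R -> \bar R) (a b c : R) :
  on_rV3 L (vec3 a b c) = L a b c.
Proof. by rewrite /on_rV3 !mxE. Qed.

(** * The extended Lagrangian *)

Definition clamp (R : realType) (T t : R) : R := Num.max 0 (Num.min T t).

Lemma clamp_itv (R : realType) (T t : R) : 0 < T -> clamp T t \in `[0, T].
Proof.
move=> T0.
by rewrite in_itv /= /clamp le_max lexx /= ge_max (ltW T0) ge_min lexx.
Qed.

Lemma clamp_lip (R : realType) (T s t : R) :
  `|clamp T s - clamp T t| <= `|s - t|.
Proof.
have mono (a b : R) : a <= b -> 0 <= clamp T b - clamp T a <= b - a.
  move=> ab; rewrite /clamp; case: (leP T a) => ?; case: (leP T b) => ?;
    case: (leP 0 T) => ?; case: (leP 0 a) => ?; case: (leP 0 b) => ?;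
    apply/andP; split; lra.
case: (leP s t) => [|/ltW] /mono /andP[h1 h2].
  by rewrite distrC (distrC s) !ger0_norm //; exact: le_trans h1 h2.
by rewrite !ger0_norm //; exact: le_trans h1 h2.
Qed.

(** Since e <= b / 2, also a >= b / 2, and 1 / a - 1 / b <= e / (a b) is at most
2 e / b^2. *)
Lemma inv_perturb (R : realType) (b a s e : R) :
  0 <= s -> 0 < b -> b - e <= a -> 2 * e <= b -> 0 <= e ->
  s / (2 * a) <= s / (2 * b) + s * e / b ^+ 2.
Proof.
move=> s0 b0 ab eb e0; have a0 : 0 < a by lra.
have -> : s / (2 * b) + s * e / b ^+ 2 = s * (b + 2 * e) / (2 * b ^+ 2).
  by field; rewrite gt_eqF.
rewrite -mulrA ler_wpM2l // ler_pdivlMr ?mulr_gt0 ?exprn_gt0 //.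
rewrite mulrC ler_pdivrMr ?mulr_gt0 // expr2.
nra.
Qed.

Section lagrangian.
Context (R : realType) (T : R) (T0 : 0 < T) (phi : R * R -> R)
  (phiL : classL T phi).

Lemma lagrangianE t x v :
  lagrangian T phi t x v = lagrangian0 phi (clamp T t) x v.
Proof.
rewrite /lagrangian /clamp.
have [t0|t0] := ltP t 0.
  by rewrite (min_r (ltW (lt_trans t0 T0))) max_l // ltW.
have [Tt|tT] := ltP T t; first by rewrite max_r // ltW.
by rewrite max_r.
Qed.

Lemma classL_gt0 t x : (0 < phi (clamp T t, x)) = (clamp T t != x).
Proof.
have [_ phi0 phiE] := phiL.
rewrite lt_neqAle eq_sym phi0 ?andbT; last exact: clamp_itv.
by congr (~~ _); apply/eqP/eqP => /phiE; apply; exact: clamp_itv.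
Qed.

Lemma lagrangian_v0 t x : lagrangian T phi t x 0 = 0%E.
Proof.
by rewrite lagrangianE /lagrangian0 eqxx normr0 ler0n mul0r; case: ifP.
Qed.

Lemma lagrangian_gt0 t x v : 0 < phi (clamp T t, x) -> `|v| <= 2 ->
  lagrangian T phi t x v = (`|v| / (2 * phi (clamp T t, x)))%:E.
Proof.
by rewrite classL_gt0 lagrangianE /lagrangian0 => /negPf -> ->.
Qed.

Lemma lagrangian_finite t x v : v != 0 -> (lagrangian T phi t x v < +oo)%E ->
  0 < phi (clamp T t, x) /\ `|v| <= 2.
Proof.
move=> v0; rewrite lagrangianE /lagrangian0 classL_gt0 (negPf v0).
by case: eqVneq => //= _; case: ifP.
Qed.

(** * Subgradients of the Lagrangian *)

(** The Lagrangian vanishes wherever the velocity does, also on the line t = x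
where it is infinite for every other velocity; so it does not grow in the
direction (w1, w2, 0), along which the slope of the subgradient is
|(w1, w2)|^2. *)
Lemma subgradient_at_rest t x w1 w2 p :
  subdifferential (on_rV3 (lagrangian T phi)) (vec3 t x 0) (vec3 w1 w2 p) ->
  enorm (vec2 w1 w2) = 0.
Proof.
move=> sub; have : dot (vec3 w1 w2 p) (vec3 w1 w2 0) <= 0.
  apply: (subdifferential_dir (a := 0)) sub _.
    by rewrite on_rV3_vec3 lagrangian_v0.
  near=> h; rewrite vec3_ray on_rV3_vec3 mulr0 addr0 lagrangian_v0.
  by rewrite mul0r addr0.
rewrite dot_vec3 mulr0 addr0 -enorm_vec2_sqr => w0; apply/eqP.
by rewrite -sqrf_eq0 eq_le w0 sqr_ge0.
Unshelve. all: by end_near. Qed.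

(** Moving v towards 0 keeps |v| <= 2 and makes the Lagrangian decrease at the
rate |v| / (2 phi); the direction -v is admissible also when |v| = 2, where L is
not differentiable in v. *)
Lemma subgradient_velocity t x v w1 w2 p : v != 0 ->
  subdifferential (on_rV3 (lagrangian T phi)) (vec3 t x v) (vec3 w1 w2 p) ->
  1 <= 2 * phi (clamp T t, x) * `|p|.
Proof.
move=> v0 sub; have [+ _] := sub; rewrite on_rV3_vec3.
move=> /(lagrangian_finite v0)[]; set q := phi _ => q0 v2.
have vgt0 : 0 < `|v| by rewrite normr_gt0.
have : dot (vec3 w1 w2 p) (vec3 0 0 (- v)) <= - (`|v| / (2 * q)).
  apply: (subdifferential_dir (a := `|v| / (2 * q))) sub _.
    by rewrite on_rV3_vec3 lagrangian_gt0.
  near=> h.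
  have h0 : 0 < h by near: h; exact: nbhs_right_gt.
  have h1 : h < 1 by near: h; exact: nbhs_right_lt.
  have nv : `|v + h * - v| = (1 - h) * `|v|.
    have -> : v + h * - v = (1 - h) * v by ring.
    by rewrite normrM ger0_norm // subr_ge0 ltW.
  rewrite vec3_ray on_rV3_vec3 !mulr0 !addr0 lagrangian_gt0 // -/q nv.
    by rewrite lee_fin le_eqVlt; apply/orP; left; apply/eqP; field;
      rewrite gt_eqF.
  by apply: le_trans v2; rewrite ler_piMl // gerBl ltW.
rewrite dot_vec3 !mulr0 !add0r mulrN lerN2 => H.
have : `|v| / (2 * q) <= `|p| * `|v|.
  by apply: le_trans H _; rewrite -normrM ler_norm.
rewrite ler_pdivrMr ?mulr_gt0 //.
have -> : `|p| * `|v| * (2 * q) = `|v| * (2 * q * `|p|) by ring.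
by rewrite ler_pMr.
Unshelve. all: by end_near. Qed.

(** In the direction (w1, w2, 0) the subgradient has slope |(w1, w2)|^2, whereas
L = |v| / (2 phi) grows at most at the rate k |v| / (2 phi^2) times
|(w1, w2)|, since clamping the time does not increase distances. A factor 2 is
given away to replace phi at the moved point by phi at the given one. *)
Lemma subgradient_position k t x v w1 w2 p : 0 < k -> v != 0 ->
  (\forall y \near (clamp T t, x), y.1 \in `[0, T] ->
     `|phi y - phi (clamp T t, x)| <= k * `|y - (clamp T t, x)|) ->
  subdifferential (on_rV3 (lagrangian T phi)) (vec3 t x v) (vec3 w1 w2 p) ->
  enorm (vec2 w1 w2) * phi (clamp T t, x) ^+ 2 <= k * `|v|.
Proof.
move=> k0 v0 lipk sub; have [+ _] := sub; rewrite on_rV3_vec3.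
move=> /(lagrangian_finite v0)[]; set q := phi _ => q0 v2.
set D := enorm _.
have D0 : 0 <= D by exact: sqrtr_ge0.
move: D0; rewrite le_eqVlt => /predU1P[<-|D0].
  by rewrite mul0r mulr_ge0 // ltW.
have : dot (vec3 w1 w2 p) (vec3 w1 w2 0) <= `|v| * (k * D) / q ^+ 2.
  apply: (subdifferential_dir (a := `|v| / (2 * q))) sub _.
    by rewrite on_rV3_vec3 lagrangian_gt0.
  move: lipk => /nbhs_ballP[e /= e0 lipk].
  near=> h.
  have h0 : 0 < h by near: h; exact: nbhs_right_gt.
  have he : h * D < e.
    by rewrite -ltr_pdivlMr //; near: h; apply: nbhs_right_lt; rewrite divr_gt0.
  have hq : 2 * (k * (h * D)) <= q.
    have -> : 2 * (k * (h * D)) = h * (2 * (k * D)) by ring.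
    rewrite -ler_pdivlMr ?mulr_gt0 //.
    by near: h; apply: nbhs_right_le; rewrite divr_gt0 // !mulr_gt0.
  rewrite vec3_ray on_rV3_vec3 mulr0 addr0.
  set t' := t + _; set x' := x + _.
  have dist : `|(clamp T t', x') - (clamp T t, x)| <= h * D.
    rewrite prod_normE /= ge_max; apply/andP; split.
      apply: le_trans (clamp_lip _ _ _) _; rewrite /t' addrAC subrr add0r.
      rewrite normrM gtr0_norm // ler_pM2l //.
      by have := normr_le_enorm (vec2 w1 w2) 0; rewrite mxE.
    rewrite /x' addrAC subrr add0r normrM gtr0_norm // ler_pM2l //.
    by have := normr_le_enorm (vec2 w1 w2) 1; rewrite mxE.
  (* Half of q survives, so the moved point stays off the line t = x. *)
  have qq : q - k * (h * D) <= phi (clamp T t', x').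
    rewrite lerBlDl -lerBlDr; apply: le_trans (ler_norm _) _.
    rewrite distrC; apply: (le_trans (lipk (clamp T t', x') _ _)).
    - rewrite -ball_normE /= distrC; exact: le_lt_trans dist he.
    - exact: clamp_itv.
    - by rewrite ler_pM2l.
  rewrite lagrangian_gt0 //; last by apply: lt_le_trans qq; nra.
  rewrite lee_fin.
  have -> : `|v| * (k * D) / q ^+ 2 * h = `|v| * (k * (h * D)) / q ^+ 2 by ring.
  by apply: inv_perturb => //; rewrite !mulr_ge0 // ltW.
rewrite dot_vec3 mulr0 addr0 -enorm_vec2_sqr -/D.
rewrite ler_pdivlMr ?exprn_gt0 // => H.
rewrite -(ler_pM2l D0); nra.
Unshelve. all: by end_near. Qed.

End lagrangian.

Theorem mainTheorem9 (R : realType) (T : R) (hT : 0 < T) (phi : R * R -> R)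
    (hphi : classL T phi) :
  let L := lagrangian T phi in
  forall r : R, 0 < r ->
  exists2 k : R, 0 < k &
    forall t x v : R, x \in `[- r, r] ->
    forall w1 w2 p : R,
      subdifferential (on_rV3 L) (vec3 t x v) (vec3 w1 w2 p) ->
      ((enorm (vec2 w1 w2))%:E
        <= k%:E * (1 + `|v|%:E + `|L t x v|) * (1 + `|p|)%:E)%E.
Proof.
move=> L r r0.
have [lipphi _ _] := hphi.
have [k k0 lipk] : exists2 k : R, 0 < k & forall z : R * R,
    (`[0, T] `*` `[- r, r]) z -> \forall y \near z, y.1 \in `[0, T] ->
      `|phi y - phi z| <= k * `|y - z|.
  apply: (locally_lipschitz_compact lipphi).
    by apply: compact_setX; exact: segment_compact.
  by move=> z [].
exists (4 * k) => [|t x v xr w1 w2 p sub]; first by rewrite mulr_gt0.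
have [v0|v0] := eqVneq v 0.
  rewrite v0 in sub *; rewrite (subgradient_at_rest hT sub).
  apply: mule_ge0; last by rewrite lee_fin addr_ge0.
  by apply: mule_ge0; [rewrite lee_fin mulr_ge0 // ltW|rewrite !adde_ge0].
have tx : (`[0, T] `*` `[- r, r]) (clamp T t, x).
  by split=> //; exact: clamp_itv.
have q2 := subgradient_position hT hphi k0 v0 (lipk _ tx) sub.
have qp := subgradient_velocity hT hphi v0 sub.
have [+ _] := sub; rewrite on_rV3_vec3.
move=> /(lagrangian_finite hT hphi v0)[q0 v2].
rewrite /L (lagrangian_gt0 hT hphi q0 v2).
move: q0 q2 qp; set q := phi _; set D := enorm _ => q0 q2 qp.
have L0 : 0 <= `|v| / (2 * q) by rewrite divr_ge0 // mulr_ge0 // ltW.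
rewrite abse_EFin (ger0_norm L0) -!EFinD -!EFinM lee_fin.
have : D <= 4 * k * (`|v| / (2 * q)) * `|p|.
  have -> : 4 * k * (`|v| / (2 * q)) * `|p| =
      (k * `|v|) * (2 * q * `|p|) / q ^+ 2.
    by field; rewrite gt_eqF.
  rewrite ler_pdivlMr ?exprn_gt0 //; apply: (le_trans q2).
  by rewrite ler_peMr // mulr_ge0 // ltW.
move/le_trans; apply; rewrite -!mulrA ler_pM2l // ler_pM2l //.
have vp := normr_ge0 v; have pp := normr_ge0 p; nra.
Qed.
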